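(* Let $H(\theta)=H(\theta)^{T}\in\mathbb{R}^{N\times N}$ be invertible and depend differentiably on parameters $\theta\in\mathbb{R}^{n_\theta}$ (ranging over an open parameter domain). Let $T,S\subseteq\{1,\dots,N\}$ with $|T|=m_T$, $|S|=m_S$, $P=T\cap S$, $p=|P|$, and let $R(\theta)=\Pi_TH(\theta)^{-1}\Pi_S^{T}\in\mathbb{R}^{m_T\times m_S}$, where $\Pi_T,\Pi_S$ are the coordinate selections onto $T$ and $S$. Then $R(\theta)\in\mathcal{S}_P$ for every $\theta$; consequently $$\operatorname{rank}\frac{\partial R}{\partial\theta}\;\le\;\min\Bigl(n_\theta,\ m_Tm_S-\tfrac12p(p-1)\Bigr),$$ and for every target $R^{*}\in\mathbb{R}^{m_T\times m_S}$, $\|R(\theta)-R^{*}\|_F\ge\tfrac12\|B-B^{T}\|_F$, where $B=R^{*}[\tau(P),\sigma(P)]$ is the target on the shared indices. The same holds verbatim for complex symmetric invertible $H=H^{T}\in\mathbb{C}^{N\times N}$ ($T$ denoting transpose, not conjugate transpose), with $\mathcal{S}_P$ read over $\mathbb{C}$ and dimensions (ranks) counted over $\mathbb{C}$.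
   Context: $\tau:P\to\{1,\dots,m_T\}$ and $\sigma:P\to\{1,\dots,m_S\}$ are the injections giving the position of each element of $P$ inside $T$ and inside $S$; $A[\tau(P),\sigma(P)]$ is the $p\times p$ submatrix with rows and columns indexed by $P$ in one common order. $\mathcal{S}_P=\{A\in\mathbb{R}^{m_T\times m_S}: A_{\tau(r)\sigma(c)}=A_{\tau(c)\sigma(r)}\ \forall r,c\in P\}$ (over $\mathbb{C}$ in the complex case). $\|\cdot\|_F$ is the Frobenius norm. $\partial R/\partial\theta$ is the $m_Tm_S\times n_\theta$ Jacobian of the flattened block. *)

(* Defs.v *)
From HB Require Import structures.
From mathcomp Require Import all_boot all_order all_algebra.
From mathcomp Require Import all_classical all_reals all_analysis.
From mathcomp Require Import complex.

Set Implicit Arguments.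
Unset Strict Implicit.
Unset Printing Implicit Defensive.

Import Order.TTheory GRing.Theory Num.Theory.
Import numFieldNormedType.Exports.

Local Open Scope ring_scope.
Local Open Scope complex_scope.

(* Index sets are listed in increasing order: [enum_val i] is the [i]-th
   element of a subset of ['I_N]. *)

(* The coordinate selection onto T. *)
Definition selmx (K : fieldType) (N : nat) (T : {set 'I_N}) : 'M[K]_(#|T|, N) :=
  \matrix_(i, j) (j == enum_val i)%:R.

Definition block (K : fieldType) (N : nat) (T S : {set 'I_N}) (H : 'M[K]_N) :
    'M[K]_(#|T|, #|S|) :=
  selmx K T *m invmx H *m (selmx K S)^T.

(* The position inside T of the [r]-th element of a subset P of T. *)
Definition position (N : nat) (P T : {set 'I_N}) (sPT : P \subset T)
    (r : 'I_#|P|) : 'I_#|T| :=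
  enum_rank_in (fintype.subsetP sPT _ (enum_valP r)) (enum_val r).

(* The injections tau and sigma on P = T :&: S; since both are indexed by the
   rank in P, they list P in one common order. *)
Definition tau (N : nat) (T S : {set 'I_N}) : 'I_#|T :&: S| -> 'I_#|T| :=
  position (finset.subsetIl T S).

Definition sigma (N : nat) (T S : {set 'I_N}) : 'I_#|T :&: S| -> 'I_#|S| :=
  position (finset.subsetIr T S).

Arguments tau {N} T S.
Arguments sigma {N} T S.

Definition shared (K : fieldType) (N : nat) (T S : {set 'I_N})
    (A : 'M[K]_(#|T|, #|S|)) : 'M[K]_#|T :&: S| :=
  mxsub (tau T S) (sigma T S) A.

(* Membership in the subspace S_P. *)
Definition reciprocal (K : fieldType) (N : nat) (T S : {set 'I_N})
    (A : 'M[K]_(#|T|, #|S|)) : Prop :=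
  forall r c : 'I_#|T :&: S|,
    A (tau T S r) (sigma T S c) = A (tau T S c) (sigma T S r).

Definition frobenius (R : realType) (m n : nat) (A : 'M[R]_(m, n)) : R :=
  Num.sqrt (\sum_i \sum_j `|A i j| ^+ 2).

(* [normc] is the modulus of a complex number, as an element of R. *)
Definition frobeniusC (R : realType) (m n : nat) (A : 'M[R[i]]_(m, n)) : R :=
  Num.sqrt (\sum_i \sum_j (ComplexField.Normc.normc (A i j)) ^+ 2).

Section RealParameters.
Variables (R : realType) (k m n : nat).

(* The library's ['J] acts on row vectors on the right, so its rows are indexed
   by the parameters; the transpose has one row per entry of the block. *)
Definition Jacobian (F : 'rV[R]_k -> 'M[R]_(m, n)) (t : 'rV[R]_k) :
    'M[R]_(m * n, k) :=
  ('J (fun u => mxvec (F u)) t)^T.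

(* R[i] is not a normed module over R in the libraries, so a complex-valued
   function of real parameters is differentiated through its real and imaginary
   parts, taken entrywise. *)
Definition differentiableC (F : 'rV[R]_k -> 'M[R[i]]_(m, n)) (t : 'rV[R]_k) :
    Prop :=
  differentiable (fun u => map_mx (@complex.Re R) (F u)) t /\
  differentiable (fun u => map_mx (@complex.Im R) (F u)) t.

Definition JacobianC (F : 'rV[R]_k -> 'M[R[i]]_(m, n)) (t : 'rV[R]_k) :
    'M[R[i]]_(m * n, k) :=
  \matrix_(a, l)
    (Jacobian (fun u => map_mx (@complex.Re R) (F u)) t a l +i*
     Jacobian (fun u => map_mx (@complex.Im R) (F u)) t a l).

End RealParameters.

(* Main.v *)
(* H^-1 inherits the symmetry of H, so an entry of the block with row and column
   in P equals its mirror image on the whole open set U.  Mirrored entries have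
   equal derivatives, so p(p-1)/2 rows of the Jacobian repeat other rows.  For
   the distance to a target X, let E and B be the restrictions of R - X and of X
   to the shared indices: the block cancels in E^T - E = B - B^T, whence
   ||B - B^T||_F <= 2 ||E||_F <= 2 ||R - X||_F.  Complex entries are handled
   over [Rcomplex R], i.e. R[i] normed by the real-valued modulus. *)
Require Import Defs.
From HB Require Import structures.
From mathcomp Require Import all_boot all_order all_algebra.
From mathcomp Require Import all_classical all_reals all_analysis.
From mathcomp Require Import complex.
From mathcomp Require Import ring lra.

Set Implicit Arguments.
Unset Strict Implicit.
Unset Printing Implicit Defensive.

Import Order.TTheory GRing.Theory Num.Theory.
Import numFieldNormedType.Exports.

Local Open Scope ring_scope.
Local Open Scope complex_scope.

(** Every row of [A] is a copy of one indexed by the image of [f], so [A] factors through a matrix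
    with only that many rows. *)
Lemma rank_rowsub_le_card_image (K : fieldType) (m n : nat) (A : 'M[K]_(m, n))
    (f : 'I_m -> 'I_m) :
  (forall i l, A (f i) l = A i l) ->
  (\rank A <= #|[set f i | i : 'I_m]|)%N.
Proof.
move=> fA; set Q := [set f i | i : 'I_m].
have fQ i : f i \in Q by exact: imset_f.
pose g i : 'I_#|Q| := enum_rank_in (fQ i) (f i).
have -> : A = rowsub g (rowsub enum_val A).
  by apply/matrixP => i l; rewrite !mxE enum_rankK_in// fA.
by rewrite rowsubE (leq_trans (mxrankM_maxr _ _))// rank_leq_row.
Qed.

Lemma card_ordered_pairs (p : nat) :
  #|[set cr : 'I_p * 'I_p | cr.2 < cr.1]%N| = (p * p.-1)./2.
Proof.
transitivity (\sum_(c < p) \sum_(r < p | (r < c)%N) 1)%N.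
  by rewrite pair_big_dep -sum1_card; apply: eq_bigl => cr; rewrite inE.
rewrite -bin2 -bin2_sum big_mkord; apply: eq_bigr => c _.
by rewrite -(big_ord_widen _ (fun=> 1%N) (ltnW (ltn_ord c))) sum1_card card_ord.
Qed.

Lemma uncurry_mxvec_index_inj (m n : nat) :
  injective (uncurry (@mxvec_index m n)).
Proof. by have [g gK _] := curry_mxvec_bij m n => x y /(congr1 g); rewrite !gK. Qed.

Section MirroredRows.
Variables (K : fieldType) (m n p q : nat).
Variables (f : 'I_p -> 'I_m) (g : 'I_p -> 'I_n).
Hypotheses (f_inj : injective f) (g_inj : injective g).

Let entry (cr : 'I_p * 'I_p) : 'I_(m * n) := mxvec_index (f cr.1) (g cr.2).

Let entry_inj : injective entry.
Proof.
move=> [c r] [c' r'] /(@uncurry_mxvec_index_inj _ _ (_, _) (_, _)).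
by case=> /f_inj-> /g_inj->.
Qed.

(* Redirecting each row below the diagonal to its mirror image leaves [A]
   unchanged and avoids the (p * p.-1)./2 redirected rows. *)
Lemma rank_mirrored_rows (A : 'M[K]_(m * n, q)) :
  (forall r c l, A (mxvec_index (f r) (g c)) l = A (mxvec_index (f c) (g r)) l) ->
  (\rank A <= m * n - (p * p.-1)./2)%N.
Proof.
move=> symA; pose D := [set cr : 'I_p * 'I_p | cr.2 < cr.1]%N.
pose mirror a :=
  if [pick cr in D | entry cr == a] is Some cr then entry (cr.2, cr.1) else a.
have mirrorA a l : A (mirror a) l = A a l.
  by rewrite /mirror; case: pickP => // -[c r] /andP[_ /eqP <-]; exact: symA.
apply: leq_trans (rank_rowsub_le_card_image mirrorA) _.
rewrite -card_ordered_pairs -(card_imset _ entry_inj) -[X in (X - _)%N]card_ord.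
rewrite -(cardsC (entry @: D)) addKn subset_leq_card//.
apply/fintype.subsetP => _ /imsetP[a _ ->].
(* A redirected index lands strictly above the diagonal, so it is no [entry] of a pair in [D]; an
   index left fixed is outside [entry @: D] because [pick] failed. *)
rewrite inE; apply/imsetP => -[[c' r'] D'] /=; rewrite /mirror.
case: pickP => [[c r] /andP[Dcr _] /entry_inj[rc' cr']|/(_ (c', r'))].
  by move: D' Dcr; rewrite !inE/= -rc' -cr' => /ltnW; rewrite leqNgt => /negP.
by rewrite D' => /= + aE; rewrite aE eqxx.
Qed.

End MirroredRows.

(* If [F] is not differentiable at [t], its differential there is 0 by
   convention ([get] on an empty predicate returns the default linear map). *)
Lemma Jacobian_eq_rows (R : realType) (k m n : nat)
    (F : 'rV[R]_k -> 'M[R]_(m, n)) (t : 'rV[R]_k) i j i' j' l :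
  (\near t, F t i j = F t i' j') ->
  Jacobian F t (mxvec_index i j) l = Jacobian F t (mxvec_index i' j') l.
Proof.
move=> eqF; rewrite /Jacobian mxE [RHS]mxE /jacobian mxE [RHS]mxE.
set f := fun u => mxvec (F u).
have [df|ndf] := pselect (differentiable f t).
  (* The differential along a basis vector is an entrywise directional derivative, which depends
     only on the germ of each entry at [t]. *)
  have derE : 'd f t (delta_mx 0 l) =
      \matrix_(a < 1, b < m * n) 'D_(delta_mx 0 l) (fun u => f u a b) t.
    by rewrite -deriveE// derive_mx//; exact: diff_derivable.
  rewrite derE !mxE; apply: near_eq_derive.
  by apply: filterS eqF => u; rewrite /f !mxvecE.
suff -> : 'd f t = \0 :> (_ -> _) by rewrite !mxE.
have := ndf; rewrite diffP /diff.
by case: xgetP => [df _ dfP /(_ dfP)//|_ _]; exact: funext.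
Qed.

Section SymmetryDefect.
Variables (R : rcfType) (V : normedZmodType R).

(** Entries lie in [V] but the value lies in [R], so one argument serves both real and complex
    matrices. *)
Definition sqnorm (m n : nat) (M : 'M[V]_(m, n)) : R :=
  \sum_i \sum_j `|M i j| ^+ 2.

Lemma sqr_normB_le (x y : V) : `|x - y| ^+ 2 <= 2 * (`|x| ^+ 2 + `|y| ^+ 2).
Proof.
apply: (@le_trans _ _ ((`|x| + `|y|) ^+ 2)).
  by rewrite lerXn2r ?nnegrE ?ler_normB ?addr_ge0.
(* With a and b the two norms, 2(a^2 + b^2) - (a + b)^2 = (a - b)^2. *)
by have := sqr_ge0 (`|x| - `|y|); lra.
Qed.

(** Injectivity makes the left side a partial sum of the nonnegative terms on the right. *)
Lemma sqnorm_mxsub_le (m n p q : nat) (f : 'I_p -> 'I_m) (g : 'I_q -> 'I_n)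
    (M : 'M[V]_(m, n)) :
  injective f -> injective g -> sqnorm (mxsub f g M) <= sqnorm M.
Proof.
move=> f_inj g_inj; rewrite /sqnorm !pair_big /=.
under eq_bigr do rewrite mxE.
pose h (rc : 'I_p * 'I_q) := (f rc.1, g rc.2).
rewrite -(big_imset (fun ij => `|M ij.1 ij.2| ^+ 2) (h := h)) /=; last first.
  by move=> [r c] [r' c'] _ _ [/f_inj-> /g_inj->].
rewrite [leRHS](bigID [in [set h rc | rc : 'I_p * 'I_q]])/= lerDl.
by apply: sumr_ge0 => ij _; exact: sqr_ge0.
Qed.

(** The constant 4 is the 2 of [sqr_normB_le] times 2, since each entry of [E] occurs in two
    differences. *)
Lemma sqnorm_trmx_sub_le (p : nat) (E : 'M[V]_p) :
  sqnorm (E^T - E) <= 4 * sqnorm E.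
Proof.
have -> : 4 * sqnorm E =
    \sum_r \sum_c 2 * (`|E c r| ^+ 2 + `|E r c| ^+ 2).
  under [RHS]eq_bigr do rewrite -mulr_sumr big_split/=.
  by rewrite -mulr_sumr big_split/= exchange_big/= /sqnorm; ring.
by apply: ler_sum => r _; apply: ler_sum => c _; rewrite !mxE sqr_normB_le.
Qed.

Lemma half_symmetry_defect_le (m n p : nat) (f : 'I_p -> 'I_m)
    (g : 'I_p -> 'I_n) (A X : 'M[V]_(m, n)) :
  injective f -> injective g ->
  (forall r c, A (f r) (g c) = A (f c) (g r)) ->
  2^-1 * Num.sqrt (sqnorm (mxsub f g X - (mxsub f g X)^T))
    <= Num.sqrt (sqnorm (A - X)).
Proof.
move=> f_inj g_inj symA; set E := mxsub f g (A - X).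
have -> : mxsub f g X - (mxsub f g X)^T = E^T - E.
  by apply/matrixP => r c; rewrite !mxE (symA c r) opprB [RHS]addrC subrKA.
(* The factor 2 is moved under the root as 2^2, to match the constant 4. *)
rewrite ler_pdivrMl// -[2 in leRHS](ger0_norm (ler0n _ 2)) -sqrtr_sqr.
rewrite -sqrtrM ?sqr_ge0// ler_wsqrtr// -natrX.
by rewrite (le_trans (sqnorm_trmx_sub_le E))// ler_pM2l// sqnorm_mxsub_le.
Qed.

End SymmetryDefect.

Lemma position_inj (N : nat) (P T : {set 'I_N}) (sPT : P \subset T) :
  injective (position sPT).
Proof.
move=> r c /enum_rank_in_inj rc; apply: enum_val_inj.
by apply: rc; apply: (fintype.subsetP sPT); exact: enum_valP.
Qed.

Lemma enum_val_position (N : nat) (P T : {set 'I_N}) (sPT : P \subset T) r :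
  enum_val (position sPT r) = enum_val r.
Proof.
by rewrite enum_rankK_in//; apply: (fintype.subsetP sPT); exact: enum_valP.
Qed.

Lemma blockE (K : fieldType) (N : nat) (T S : {set 'I_N}) (H : 'M[K]_N) i j :
  block T S H i j = invmx H (enum_val i) (enum_val j).
Proof.
rewrite /block; have -> : selmx K T = rowsub enum_val 1%:M.
  by apply/matrixP => a b; rewrite !mxE eq_sym.
have -> : (selmx K S)^T = colsub enum_val 1%:M.
  by apply/matrixP => a b; rewrite !mxE.
by rewrite -rowsubE mulmx_colsub mulmx1 !mxE.
Qed.

(** [tau] and [sigma] send a rank to positions of the same element of ['I_N], so mirrored block
    entries are transposed entries of the symmetric matrix [invmx H]. *)
Lemma block_reciprocal (K : fieldType) (N : nat) (T S : {set 'I_N})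
    (H : 'M[K]_N) :
  H^T = H -> reciprocal (block T S H).
Proof.
move=> symH r c; rewrite !blockE !enum_val_position.
by rewrite -[in RHS]symH -trmx_inv mxE.
Qed.

Lemma Jacobian_reciprocal (R : realType) (N k : nat) (U : set 'rV[R]_k)
    (T S : {set 'I_N}) (F : 'rV[R]_k -> 'M[R]_(#|T|, #|S|)) (t : 'rV[R]_k)
    (r c : 'I_#|T :&: S|) l :
  open U -> U t -> (forall u, U u -> reciprocal (F u)) ->
  Jacobian F t (mxvec_index (tau T S r) (sigma T S c)) l =
  Jacobian F t (mxvec_index (tau T S c) (sigma T S r)) l.
Proof.
move=> openU Ut symF; apply: Jacobian_eq_rows.
by apply: filterS (open_nbhs_nbhs (conj openU Ut)) => u /symF; exact.
Qed.

Theorem theorem4 (R : realType) (N k : nat) (U : set 'rV[R]_k) (hU : open U)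
    (T S : {set 'I_N}) :
  let p := #|T :&: S| in
  let bound := minn k (#|T| * #|S| - (p * p.-1)./2)%N in
  (forall H : 'rV[R]_k -> 'M[R]_N,
     (forall t, U t ->
        [/\ (H t)^T = H t, H t \in unitmx & differentiable H t]) ->
     forall t, U t ->
       [/\ reciprocal (block T S (H t)),
           (\rank (Jacobian (fun u => block T S (H u)) t) <= bound)%N
         & forall X : 'M[R]_(#|T|, #|S|),
             2^-1 * frobenius (shared X - (shared X)^T)
               <= frobenius (block T S (H t) - X)])
  /\
  (forall H : 'rV[R]_k -> 'M[R[i]]_N,
     (forall t, U t ->
        [/\ (H t)^T = H t, H t \in unitmx & differentiableC H t]) ->
     forall t, U t ->
       [/\ reciprocal (block T S (H t)),
           (\rank (JacobianC (fun u => block T S (H u)) t) <= bound)%N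
         & forall X : 'M[R[i]]_(#|T|, #|S|),
             2^-1 * frobeniusC (shared X - (shared X)^T)
               <= frobeniusC (block T S (H t) - X)]).
Proof.
move=> p bound; rewrite /bound; split=> H symH t Ut.
  have recF u : U u -> reciprocal (block T S (H u)).
    by case/symH => Hu _ _; exact: block_reciprocal.
  split; first exact: recF.
    rewrite leq_min rank_leq_col/=.
    apply: (@rank_mirrored_rows _ _ _ _ _ (tau T S) (sigma T S));
      [exact: position_inj|exact: position_inj|] => r c l.
    exact: Jacobian_reciprocal hU Ut recF.
  move=> X.
  by apply: (@half_symmetry_defect_le R R);
    [exact: position_inj|exact: position_inj|exact: recF].
have recF u : U u -> reciprocal (block T S (H u)).
  by case/symH => Hu _ _; exact: block_reciprocal.
split; first exact: recF.
  rewrite leq_min rank_leq_col/=.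
  apply: (@rank_mirrored_rows _ _ _ _ _ (tau T S) (sigma T S));
    [exact: position_inj|exact: position_inj|] => r c l.
  (* The real and imaginary parts of the block are each reciprocal on [U], so the real result
     applies to both. *)
  rewrite [LHS]mxE [RHS]mxE; congr (_ +i* _);
    apply: (Jacobian_reciprocal _ _ _ hU Ut);
    by move=> u Uu r' c'; rewrite [LHS]mxE [RHS]mxE recF.
move=> X.
by apply: (@half_symmetry_defect_le R (Rcomplex R));
  [exact: position_inj|exact: position_inj|exact: recF].
Qed.
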